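(* Let $I\subset S=K[X_1,\dots,X_n]$ be a homogeneous ideal, let $s\in I$ be a strongly inessential element of $I$, and let $z\in S$ be a linear form which is regular for $S/I$ (i.e. a non-zero-divisor on $S/I$). Let $\bar{\ }\colon S\to S/zS$ be the canonical morphism. Then $\bar s$ is a strongly inessential element of the ideal $\bar I\subset S/zS$.
   Context: $K$ is an algebraically closed field, $S=K[X_1,\dots,X_n]$, $\mathfrak M=(X_1,\dots,X_n)$. The ring $S/zS$ is regarded as a polynomial ring in $n-1$ variables with irrelevant ideal $\bar{\mathfrak M}$, and the following definitions apply to it as well. For a homogeneous ideal $I=\bigoplus_d I_d$, a standard basis of $I$ is an ordered set of forms generating $I$ such that its elements of degree $d$ define a $K$-basis of $I_d/(I_{d-1}S_1)$ for every $d$. Given a standard basis $\mathcal B$ of $I$, an element $f\in\mathcal B$ is inessential with respect to $\mathcal B$ if there is $t\in\mathbb N$ with $f\,\mathfrak M^t\subseteq(\mathcal B\setminus\{f\})S$. A form $f\in I_d$ is strongly inessential if $f\notin I_{d-1}S$ and $f$ is inessential with respect to every standard basis of $I$ containing it. *)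

(* Defs.v *)
From HB Require Import structures.
From mathcomp Require Import all_boot all_algebra.
From mathcomp Require Import ring_quotient.
From mathcomp Require Import boolp classical_sets.
From mathcomp Require Import mpoly.

Set Implicit Arguments.
Unset Strict Implicit.
Unset Printing Implicit Defensive.

Import GRing.Theory.
Local Open Scope classical_set_scope.
Local Open Scope ring_scope.
Local Open Scope quotient_scope.

(** ** Ideals of a commutative ring (possibly improper) *)

Section Ideals.
Variable A : comNzRingType.
Implicit Types (I J G : set A).

Definition is_ideal I : Prop :=
  [/\ I 0, forall f g, I f -> I g -> I (f + g) & forall a f, I f -> I (a * f)].

(* The ideal [G A]; [ideal_gen set0] is the zero ideal. *)
Definition ideal_gen G : set A :=
  [set f | exists2 r : seq (A * A),
     forall p, p \in r -> G p.2 & f = \sum_(p <- r) p.1 * p.2].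

Definition ideal_mul I J : set A :=
  ideal_gen [set f * g | f in I & g in J].

Definition ideal_exp I (t : nat) : set A := iter t (ideal_mul I) setT.

(* [z] is a non-zero-divisor on [A / I]; [A / I] may be the zero ring. *)
Definition regular_mod I (z : A) : Prop := forall f, I (z * f) -> I f.

End Ideals.

(** ** Standard bases and inessential elements *)

Section StandardBases.
Variables (K : fieldType) (n : nat).
Local Notation S := {mpoly K[n]}.
Implicit Types (I : set S) (B : seq S) (d : nat) (f s : S).

Definition irrelevant : set S := ideal_gen (range (fun i : 'I_n => 'X_i : S)).

Definition homogeneous_ideal I : Prop :=
  is_ideal I /\ forall d f, I f -> I (pihomog mdeg d f).

(* [I_d] *)
Definition ideal_part I d : set S := [set f | I f /\ f \is d.-homog].

(* [I_(d-1)], where [I_(-1)] is the zero space *)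
Definition ideal_part_pred I d : set S :=
  if d is e.+1 then ideal_part I e else [set 0].

(* The subspace [I_(d-1) S_1] of [I_d]: no scalars are needed in the sums, as
   [S_1] absorbs them. *)
Definition ideal_part_ext I d : set S :=
  [set f | exists2 r : seq (S * S),
     forall p, p \in r -> ideal_part_pred I d p.1 /\ p.2 \is 1.-homog
     & f = \sum_(p <- r) p.1 * p.2].

(* The classes of the elements of [B] form a [K]-basis of [I_d/(I_(d-1) S_1)]. *)
Definition basis_of_part I d B : Prop :=
  [/\ forall f, f \in B -> ideal_part I d f,
      forall f, ideal_part I d f -> exists c : 'I_(size B) -> K,
        ideal_part_ext I d (f - \sum_i c i *: B`_i)
    & forall c : 'I_(size B) -> K,
        ideal_part_ext I d (\sum_i c i *: B`_i) -> forall i, c i = 0].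

(* Sequences render ordered sets: [S] being Noetherian, a standard basis is
   finite, and [basis_of_part] excludes repetitions. It also excludes 0, the only
   form that would be selected in several degrees. *)
Definition standard_basis I B : Prop :=
  [/\ forall f, f \in B -> exists d, f \is d.-homog,
      ideal_gen [set` B] = I
    & forall d, basis_of_part I d [seq f <- B | f \is d.-homog]].

Definition inessential B f : Prop :=
  f \in B /\
  exists t : nat, forall g, ideal_exp irrelevant t g ->
    ideal_gen [set h | h \in B /\ h != f] (f * g).

Definition strongly_inessential I s : Prop :=
  exists d, [/\ ideal_part I d s,
                ~ ideal_gen (ideal_part_pred I d) s
              & forall B, standard_basis I B -> s \in B -> inessential B s].

End StandardBases.

(** ** The quotient [S/zS] by a linear form

    [dhomog n K 1] is the type of homogeneous polynomials of degree 1, zero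
    included. *)

Section LinearQuotient.
Variables (K : fieldType) (n : nat) (z : dhomog n K 1).
Local Notation S := {mpoly K[n]}.

Definition principal : {pred S} :=
  [pred f : S | `[< exists h : S, f = h * mpoly_of_dhomog z >]].

Lemma principal_idealr : idealr_closed principal.
Proof.
split.
- by apply/asboolP; exists 0; rewrite mul0r.
- apply/negP => /asboolP[h /(congr1 (mcoeff 0%MM))].
  have z0 : (mpoly_of_dhomog z)@_0%MM = 0.
    by apply: (dhomog_nemf_coeff (dhomog_is_dhomog z)); rewrite mf0.
  by move=> /eqP; rewrite rmorphM /= [mcoeff 0%MM z]z0 mulr0 mcoeff1 eqxx oner_eq0.
- move=> a u v /asboolP[h ->] /asboolP[k ->]; apply/asboolP.
  by exists (a * h + k); rewrite mulrDl mulrA.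
Qed.

HB.instance Definition _ := isIdealr.Build S principal principal_idealr.

Local Notation lin_quot := {ideal_quot principal}.

(* An isomorphism of graded [K]-algebras from [S/zS] to the polynomial ring in
   [n - 1] variables; there is one whenever [z != 0]. *)
Definition graded_iso (psi : {rmorphism lin_quot -> {mpoly K[n.-1]}}) : Prop :=
  [/\ bijective psi,
      forall c : K, psi (\pi_lin_quot (c%:MP : S)) = c%:MP
    & forall d (f : S), f \is d.-homog -> psi (\pi_lin_quot f) \is d.-homog].

End LinearQuotient.

Notation lin_quot z := {ideal_quot (principal z)}.

(* Main.v *)
Require Import Defs.
From mathcomp Require Import all_boot all_algebra.
From mathcomp Require Import ring_quotient.
From mathcomp Require Import boolp classical_sets.
From mathcomp Require Import mpoly.

(** Write [phi] for the graded surjection [S -> S/zS] and [barI] for the image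
    of [I]. Everything rests on the fact that [phi] induces isomorphisms from
    [I_d/(I_(d-1) S_1)] to [barI_d/(barI_(d-1) (S/zS)_1)]. A form of [I_d] killed
    by [phi] is some [h z]; regularity puts [h] back in [I], and since [z] is a
    linear form, [h z] is in [I_(d-1) S_1]. Hence a form of [I_d] whose image lies
    in [barI_(d-1) (S/zS)_1] lies in [I_(d-1) S_1] ([ext_reflect]).

    Two facts follow. First, [phi s] is not in the ideal generated by
    [barI_(d-1)], because [s] is not in the one generated by [I_(d-1)]. Second,
    choosing for each element of a standard basis [C] of [barI] a preimage in [I]
    of the same degree gives a standard basis of [I] ([standard_basis_lift]):
    the isomorphisms transport bases of the quotients, and forms of [I] that
    represent such bases in every degree generate [I] by induction on the degree
    ([basis_of_part_gen], a graded form of the Nakayama lemma). If [phi s] is in [C], its preimage may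
    be taken to be [s]. Then [s] is inessential for the lifted basis, and applying
    [phi] to the inclusion that expresses this shows that [phi s] is inessential
    for [C] ([inessential_image]), since powers of the irrelevant ideal of [S]
    map onto those of [S/zS]. *)

Set Implicit Arguments.
Unset Strict Implicit.
Unset Printing Implicit Defensive.

Local Open Scope classical_set_scope.
Local Open Scope ring_scope.
Local Open Scope quotient_scope.

Import GRing.Theory.

(** * Ideals and ring morphisms *)

Section IdealTheory.
Variable A : comNzRingType.
Implicit Types (I J G : set A).

Lemma ideal_sum I (T : eqType) (r : seq T) (F : T -> A) :
  is_ideal I -> (forall p, p \in r -> I (F p)) -> I (\sum_(p <- r) F p).
Proof.
case=> I0 ID _ Fr; rewrite big_seq.
by elim/big_ind: _ => // x y; apply: ID.
Qed.

Lemma ideal_gen_is_ideal G : is_ideal (ideal_gen G).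
Proof.
split; first by exists [::]; rewrite ?big_nil.
- move=> _ _ [r rG ->] [r' r'G ->]; exists (r ++ r'); last by rewrite big_cat.
  by move=> p; rewrite mem_cat => /orP[/rG|/r'G].
- move=> a _ [r rG ->]; exists [seq (a * p.1, p.2) | p <- r].
    by move=> _ /mapP[p /rG Gp ->].
  by rewrite mulr_sumr big_map; apply: eq_bigr => p _; rewrite mulrA.
Qed.

Lemma ideal_gen_self G : G `<=` ideal_gen G.
Proof.
move=> g Gg; exists [:: (1, g)]; last by rewrite big_seq1 mul1r.
by move=> p; rewrite inE => /eqP->.
Qed.

Lemma ideal_gen_min G J : is_ideal J -> G `<=` J -> ideal_gen G `<=` J.
Proof.
move=> Jid GJ _ [r rG ->]; apply: ideal_sum => // p /rG/GJ.
by case: Jid => _ _; apply.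
Qed.

Lemma ideal_mul_pair I J f g : I f -> J g -> ideal_mul I J (f * g).
Proof. by move=> If Jg; apply: ideal_gen_self; exists f => //; exists g. Qed.

End IdealTheory.

Section IdealMorphism.
Variables (A A' : comNzRingType) (phi : {rmorphism A -> A'}).

Lemma preimage_is_ideal (J : set A') : is_ideal J -> is_ideal (phi @^-1` J).
Proof.
case=> J0 JD JM; split=> [|f g|a f] /=; first by rewrite rmorph0.
- by rewrite rmorphD; apply: JD.
- by rewrite rmorphM; apply: JM.
Qed.

Lemma image_is_ideal (I : set A) :
  (forall g, exists f, phi f = g) -> is_ideal I -> is_ideal (phi @` I).
Proof.
move=> phi_surj [I0 ID IM]; split; first by exists 0; rewrite ?rmorph0.
- move=> _ _ [f If <-] [g Ig <-]; exists (f + g); last exact: rmorphD.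
  exact: ID.
- move=> a' _ [f If <-]; have [a <-] := phi_surj a'.
  by exists (a * f); [exact: IM | exact: rmorphM].
Qed.

(** Only [J' `<=` phi @` J] is asked, not an inclusion between generating sets:
    a variable of [S/zS] lifts to a linear form, which need not be a variable. *)
Lemma ideal_exp_lift (J : set A) (J' : set A') (t : nat) :
    (forall g, exists f, phi f = g) -> J' `<=` phi @` J ->
  ideal_exp J' t `<=` phi @` ideal_exp J t.
Proof.
move=> phi_surj J'J; elim: t => [|t IHt] g.
  by have [f] := phi_surj g; exists f.
apply: ideal_gen_min; first exact/image_is_ideal/ideal_gen_is_ideal.
move=> _ [_ /J'J[f Jf <-] [_ /IHt[h Jh <-] <-]].
by exists (f * h); [exact: ideal_mul_pair | exact: rmorphM].
Qed.

End IdealMorphism.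

(** * Forms of a homogeneous ideal and the spaces [I_(d-1) S_1] *)

Section Forms.
Variables (K : fieldType) (n : nat).
Local Notation S := {mpoly K[n]}.
Implicit Types (I : set S) (f g a : S) (d e k : nat) (B : seq S).

(** Extracting homogeneous components is linear over multiplication by a form,
    up to a shift: check it on the monomials of [a]. *)
Lemma pihomogMr k e a g :
  g \is e.-homog -> pihomog mdeg (k + e) (a * g) = pihomog mdeg k a * g.
Proof.
move=> g_e; rewrite [in LHS](mpolyE a) [in RHS](mpolyE a).
rewrite mulr_suml (linear_sum (pihomog mdeg _)) (linear_sum (pihomog mdeg k)).
rewrite mulr_suml; apply: eq_bigr => m _.
rewrite -scalerAl !linearZ /= -scalerAl; congr (_ *: _).
have mg_hom : 'X_[m] * g \is (mdeg m + e).-homog.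
  by apply: dhomogM => //; rewrite dhomogX.
rewrite pihomogX; have [<-|ne_mk] := eqVneq; first exact: pihomog_dE.
by rewrite mul0r (pihomog_ne0 _ mg_hom) // eqn_add2r.
Qed.

Lemma pihomogM_lt d e a g :
  g \is e.-homog -> (d < e)%N -> pihomog mdeg d (a * g) = 0.
Proof.
move=> g_e lt_de; rewrite (mpolyE a) mulr_suml linear_sum big1 // => m _.
have mg_hom : 'X_[m] * g \is (mdeg m + e).-homog.
  by apply: dhomogM => //; rewrite dhomogX.
rewrite -scalerAl linearZ /= (pihomog_ne0 _ mg_hom) ?scaler0 //.
by rewrite gtn_eqF // ltn_addl.
Qed.

Lemma linear_form_irrelevant f : f \is 1.-homog -> irrelevant f.
Proof.
move=> f_1; rewrite (mpolyE f).
have Mid : is_ideal (@irrelevant K n) by apply: ideal_gen_is_ideal.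
apply: ideal_sum => // m m_f; rewrite -mul_mpolyC.
case: (Mid) => _ _ IM; apply: (IM).
have /eqP m1 : mdeg m == 1%N by move/dhomogP: f_1 => /(_ _ m_f) ->.
(* A monomial of degree 1 involves some variable, which can be factored out. *)
have [i mi|m0] := pickP (fun i => m i != 0%N); last first.
  by move: m1; rewrite mdegE big1 // => i _; have /negbFE/eqP := m0 i.
have -> : m = (m - U_(i) + U_(i))%MM.
  by rewrite submK // lep1mP.
by rewrite mpolyXD; apply/IM/ideal_gen_self; exists i.
Qed.

Lemma ext0 I d : ideal_part_ext I d 0.
Proof. by exists [::]; rewrite ?big_nil. Qed.

Lemma extD I d f g :
  ideal_part_ext I d f -> ideal_part_ext I d g -> ideal_part_ext I d (f + g).
Proof.
move=> [r rI ->] [r' r'I ->]; exists (r ++ r'); last by rewrite big_cat.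
by move=> p; rewrite mem_cat => /orP[/rI|/r'I].
Qed.

Lemma extM I d f g :
  ideal_part_pred I d f -> g \is 1.-homog -> ideal_part_ext I d (f * g).
Proof.
move=> If g1; exists [:: (f, g)]; last by rewrite big_seq1.
by move=> p; rewrite inE => /eqP->.
Qed.

Lemma ext_min I d (P : set S) :
    P 0 -> (forall f g, P f -> P g -> P (f + g)) ->
    (forall f g, ideal_part_pred I d f -> g \is 1.-homog -> P (f * g)) ->
  ideal_part_ext I d `<=` P.
Proof.
move=> P0 PD PM _ [r rI ->]; rewrite big_seq.
by elim/big_ind: _ => // p /rI[]; apply: PM.
Qed.

Lemma ext_sub_gen I d : ideal_part_ext I d `<=` ideal_gen (ideal_part_pred I d).
Proof.
have [G0 GD GM] := ideal_gen_is_ideal (ideal_part_pred I d).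
apply: ext_min => // f g If _; rewrite mulrC; exact/GM/ideal_gen_self.
Qed.

(** In a combination of elements of [I_(d-1)] that is a form of degree [d], the
    coefficients may be replaced by their components of degree 1. *)
Lemma gen_part_ext I d f :
  ideal_gen (ideal_part_pred I d) f -> f \is d.-homog -> ideal_part_ext I d f.
Proof.
move=> [r rI ->] /pihomog_dE<-; rewrite linear_sum /= big_seq.
elim/big_ind: _ => [|f1 f2|p /rI]; [exact: ext0 | exact: extD |].
case: d {rI} => [->|e Ip2]; first by rewrite mulr0 linear0; apply: ext0.
have p2_e : p.2 \is e.-homog by case: Ip2.
rewrite -[in pihomog _ _](add1n e) (pihomogMr _ _ p2_e) mulrC.
by apply: extM => //; apply: pihomogP.
Qed.

Lemma ideal_partD I d f g :
  is_ideal I -> ideal_part I d f -> ideal_part I d g -> ideal_part I d (f + g).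
Proof.
by move=> [_ ID _] [If fd] [Ig gd]; split; [exact: ID | exact: rpredD].
Qed.

Lemma ideal_partZ I d c f :
  is_ideal I -> ideal_part I d f -> ideal_part I d (c *: f).
Proof.
by move=> [_ _ IM] [If fd]; split; [rewrite -mul_mpolyC; exact: IM | exact: rpredZ].
Qed.

Lemma ext_sub_part I d : is_ideal I -> ideal_part_ext I d `<=` ideal_part I d.
Proof.
move=> Iid; have [I0 ID IM] := Iid.
apply: ext_min => [|f g|f g].
- by split=> //; apply: rpred0.
- exact: ideal_partD.
case: d => [->|e [If fe] g1]; first by rewrite mul0r; split=> //; apply: rpred0.
by split; [rewrite mulrC; apply: IM | rewrite -addn1; apply: dhomogM].
Qed.

(** Graded Nakayama: modulo the span of the degree [d] elements of [B], a form of
    [I_d] lies in [I_(d-1) S_1], which induction on [d] puts in the ideal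
    generated by [B]. Hence the degreewise condition on a standard basis implies
    that it generates [I]. *)
Lemma basis_of_part_gen I B :
    homogeneous_ideal I -> (forall f, f \in B -> I f) ->
    (forall d, basis_of_part I d [seq f <- B | f \is d.-homog]) ->
  ideal_gen [set` B] = I.
Proof.
move=> [Iid Ihom] BI Bbas; have [J0 JD JM] := ideal_gen_is_ideal [set` B].
apply/seteqP; split; first exact: ideal_gen_min.
have part_gen d f : ideal_part I d f -> ideal_gen [set` B] f.
  elim/ltn_ind: d f => d IHd f If.
  have [_ /(_ f If)[c ext_f] _] := Bbas d.
  rewrite -[f](subrK (\sum_i c i *: [seq f <- B | f \is d.-homog]`_i)).
  apply: (JD).
    apply: (ext_min (P := ideal_gen [set` B])) ext_f => // g h Ig _.
    rewrite mulrC; apply: (JM).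
    by case: d IHd {If c} Ig => [|e] IHd => [->|] //; apply: IHd.
  apply: ideal_sum => [|i _]; first exact: ideal_gen_is_ideal.
  rewrite -mul_mpolyC; apply/JM/ideal_gen_self => /=.
  by have := mem_nth 0 (ltn_ord i); rewrite mem_filter => /andP[].
move=> f If; rewrite (pihomog_partitionE (leqnn (mmeasure mdeg f))).
apply: ideal_sum => [|d _]; first exact: ideal_gen_is_ideal.
by apply: (part_gen d); split; [exact: Ihom | exact: pihomogP].
Qed.

End Forms.

(** * Passing to the quotient by a regular linear form *)

Section GradedQuotient.
Variables (K : fieldType) (m n : nat).
Variables (phi : {rmorphism {mpoly K[m]} -> {mpoly K[n]}}) (z : {mpoly K[m]}).
Hypotheses (phi_surj : forall g, exists f, phi f = g)
           (phiC : forall c : K, phi c%:MP = c%:MP)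
           (phi_homog : forall d f, f \is d.-homog -> phi f \is d.-homog)
           (phi_ker : forall f, phi f = 0 -> exists h, f = h * z)
           (z_1 : z \is 1.-homog).

Lemma morphZ c f : phi (c *: f) = c *: phi f.
Proof. by rewrite -!mul_mpolyC rmorphM phiC. Qed.

(** [phi] carries the decomposition of [f] into forms to that of [phi f], so that
    homogeneous elements have homogeneous preimages. *)
Lemma morph_pihomog d f : phi (pihomog mdeg d f) = pihomog mdeg d (phi f).
Proof.
(* Summing up to [deg f + d] ensures that the index [d] occurs in the sum. *)
have le_f : (mmeasure mdeg f <= mmeasure mdeg f + d.+1)%N by apply: leq_addr.
have lt_d : (d < mmeasure mdeg f + d.+1)%N by rewrite addnS ltnS leq_addl.
rewrite [in RHS](pihomog_partitionE le_f) [in RHS]rmorph_sum [in RHS]linear_sum.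
have hom k : phi (pihomog mdeg k f) \is k.-homog by apply/phi_homog/pihomogP.
rewrite [in RHS](bigD1 (Ordinal lt_d)) //= big1 => [|k ne_kd].
  by rewrite addr0 (pihomog_dE (hom d)).
exact: (pihomog_ne0 ne_kd).
Qed.

Lemma form_lift d g : g \is d.-homog -> exists2 f, f \is d.-homog & phi f = g.
Proof.
move=> g_d; have [f fg] := phi_surj g.
exists (pihomog mdeg d f); first exact: pihomogP.
by rewrite morph_pihomog fg pihomog_dE.
Qed.

Lemma irrelevant_lift : @irrelevant K n `<=` phi @` @irrelevant K m.
Proof.
apply: ideal_gen_min; first exact/image_is_ideal/ideal_gen_is_ideal.
move=> _ [i _ <-]; have [|f f_1 <-] := @form_lift 1%N ('X_i).
  by rewrite dhomogX /= mdeg1.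
by exists f => //; apply: linear_form_irrelevant.
Qed.

Variable I : set {mpoly K[m]}.
Hypotheses (I_homog : homogeneous_ideal I) (z_reg : regular_mod I z).
Let I_ideal : is_ideal I. Proof. by case: I_homog. Qed.
Local Notation barI := (phi @` I).

Lemma part_lift d : ideal_part barI d `<=` phi @` ideal_part I d.
Proof.
move=> _ [[f If <-] f_d]; exists (pihomog mdeg d f).
  by split; [exact: (I_homog.2) | exact: pihomogP].
by rewrite morph_pihomog pihomog_dE.
Qed.

Lemma part_image d f : ideal_part I d f -> ideal_part barI d (phi f).
Proof. by move=> [If f_d]; split; [exists f | exact: phi_homog]. Qed.

Lemma ext_lift d : ideal_part_ext barI d `<=` phi @` ideal_part_ext I d.
Proof.
apply: ext_min => [|_ _ [f If <-] [g Ig <-]|f g If g_1].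
- by exists 0; rewrite ?rmorph0 //; apply: ext0.
- by exists (f + g); [exact: extD | exact: rmorphD].
have [h h_1 <-] := form_lift g_1.
have [k Ik <-] : (phi @` ideal_part_pred I d) f.
  case: d If => [->|d /part_lift//].
  by exists 0; rewrite ?rmorph0.
by exists (k * h); [exact: extM | exact: rmorphM].
Qed.

Lemma ext_image d f : ideal_part_ext I d f -> ideal_part_ext barI d (phi f).
Proof.
move: f; apply: ext_min => [|f g|f g If g_1] /=.
- by rewrite rmorph0; apply: ext0.
- by rewrite rmorphD; apply: extD.
rewrite rmorphM; apply: extM; last exact: phi_homog.
by case: d If => [->|d /part_image//]; rewrite /= rmorph0.
Qed.

(** The only use of regularity: [f = h z] with [h] in [I], and taking components
    of degree [d] replaces [h] by its component of degree [d - 1], also in [I]. *)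
Lemma ker_part_ext d f : ideal_part I d f -> phi f = 0 -> ideal_part_ext I d f.
Proof.
move=> [If f_d] /phi_ker[h def_f].
have Ih : I h by apply: z_reg; rewrite mulrC -def_f.
rewrite -(pihomog_dE f_d) def_f; case: d {f_d} => [|d].
  by rewrite (pihomogM_lt _ z_1) //; apply: ext0.
rewrite -addn1 (pihomogMr _ _ z_1) addn1; apply: extM => //.
by split; [exact: (I_homog.2) | exact: pihomogP].
Qed.

(** Injectivity of [I_d/(I_(d-1) S_1) -> barI_d/(barI_(d-1) (S/zS)_1)]: subtract
    from [f] a preimage of [phi f] in [I_(d-1) S_1]; the difference is a form
    of [I_d] in the kernel of [phi]. *)
Lemma ext_reflect d f :
  ideal_part I d f -> ideal_part_ext barI d (phi f) -> ideal_part_ext I d f.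
Proof.
move=> If /ext_lift[g Ig phi_fg]; rewrite -[f](subrK g); apply: extD => //.
apply: ker_part_ext; last by rewrite rmorphB phi_fg subrr.
rewrite -scaleN1r; apply: ideal_partD => //; apply: ideal_partZ => //.
exact: ext_sub_part.
Qed.

(** * Lifting standard bases *)

Section Lift.
Variable l : {mpoly K[n]} -> {mpoly K[m]}.

Lemma morph_comb C (c : 'I_(size (map l C)) -> K) :
    {in C, cancel l phi} ->
  phi (\sum_i c i *: (map l C)`_i)
    = \sum_(j < size C) c (cast_ord (esym (size_map l C)) j) *: C`_j.
Proof.
move=> lK; rewrite rmorph_sum (reindex (cast_ord (esym (size_map l C)))) /=; last first.
  apply: onW_bij; exists (cast_ord (size_map l C)).
    exact: cast_ordKV.
  exact: cast_ordK.
apply: eq_bigr => j _; rewrite morphZ (nth_map 0) // lK //.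
exact: mem_nth.
Qed.

Lemma basis_of_part_lift d C :
    {in C, cancel l phi} -> (forall c, c \in C -> ideal_part I d (l c)) ->
  basis_of_part barI d C -> basis_of_part I d (map l C).
Proof.
move=> lK lI [CI Cgen Cfree].
have lCI f : f \in map l C -> ideal_part I d f by move=> /mapP[c /lI Ic ->].
split=> // [f If|c ext_c i].
  have [c ext_c] := Cgen _ (part_image If).
  exists (c \o cast_ord (size_map l C)); apply: ext_reflect.
    apply: ideal_partD => //; rewrite -scaleN1r; apply: ideal_partZ => //.
    elim/big_ind: _ => [|f1 f2|i _].
    - by split; [case: I_ideal | exact: rpred0].
    - exact: ideal_partD.
    by apply: ideal_partZ => //; apply/lCI/mem_nth.
  rewrite rmorphB morph_comb //.
  by under eq_bigr do rewrite /= cast_ordKV.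
move/ext_image: ext_c; rewrite morph_comb // => /Cfree c0.
by rewrite -[i](cast_ordK (size_map l C)) c0.
Qed.

Lemma standard_basis_lift C :
    {in C, cancel l phi} -> (forall c, c \in C -> I (l c)) ->
    (forall c d, c \in C -> (l c \is d.-homog) = (c \is d.-homog)) ->
  standard_basis barI C -> standard_basis I (map l C).
Proof.
move=> lK lI l_homog [C_homog Cgen Cbas].
have Bbas d : basis_of_part I d [seq f <- map l C | f \is d.-homog].
  rewrite filter_map (@eq_in_filter _ _ (fun c => c \is d.-homog)); last first.
    by move=> c Cc /=; apply: l_homog.
  apply: basis_of_part_lift => // c; rewrite mem_filter => /andP[c_d Cc].
    exact: lK.
  by split; [exact: lI | rewrite l_homog].
split=> //.
  move=> _ /mapP[c Cc ->]; have [d c_d] := C_homog _ Cc.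
  by exists d; rewrite l_homog.
by apply: basis_of_part_gen => // _ /mapP[c Cc ->]; apply: lI.
Qed.

End Lift.

(** The lift is prescribed to be [s] at [phi s]. It must preserve and reflect
    every degree, so that selecting the elements of degree [d] commutes with
    lifting. A nonzero element has a single degree, which makes any homogeneous
    preimage of that degree suitable; 0 is a form of every degree and has to be
    lifted to 0. *)
Lemma homogeneous_lift d s (C : seq {mpoly K[n]}) :
    ideal_part I d s -> phi s != 0 ->
    (forall c, c \in C -> exists e, ideal_part barI e c) ->
  exists l : {mpoly K[n]} -> {mpoly K[m]},
    [/\ l (phi s) = s, {in C, cancel l phi}, forall c, c \in C -> I (l c)
      & forall c e, c \in C -> (l c \is e.-homog) = (c \is e.-homog)].
Proof.
move=> [Is s_d] phi_s0 C_homog.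
pose P c f := (c = phi s -> f = s) /\ (c \in C ->
  [/\ phi f = c, I f & forall e, (f \is e.-homog) = (c \is e.-homog)]).
(* If [phi f != 0], the degree of [f] is the one that [phi f] has. *)
have homogE f e : phi f != 0 -> f \is e.-homog ->
    forall k, (f \is k.-homog) = (phi f \is k.-homog).
  move=> phi_f0 f_e k; apply/idP/idP => [|phi_f_k]; first exact: phi_homog.
  by rewrite -(dhomog_uniq phi_f0 (phi_homog f_e) phi_f_k).
suff /choice[l lP] c : exists f, P c f.
  exists l; split; first by case: (lP (phi s)) => ->.
  - by move=> c Cc; case: (lP c) => _ /(_ Cc)[].
  - by move=> c Cc; case: (lP c) => _ /(_ Cc)[].
  - by move=> c e Cc; case: (lP c) => _ /(_ Cc)[].
have [->|ne_cs] := eqVneq c (phi s).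
  by exists s; split=> // _; split=> //; apply: (homogE _ d).
have [Cc|nCc] := boolP (c \in C); last first.
  exists 0; split=> [c_s|]; last by rewrite (negPf nCc).
  by rewrite c_s eqxx in ne_cs.
have [->|c0] := eqVneq c 0.
  exists 0; split=> [s0|_]; first by rewrite -s0 eqxx in phi_s0.
  by split=> [||e]; [exact: rmorph0 | case: I_ideal | rewrite !rpred0].
have [e /part_lift[f [If f_e] def_c]] := C_homog c Cc.
exists f; split=> [c_s|_]; first by rewrite c_s eqxx in ne_cs.
by split=> //; rewrite -def_c; apply: (homogE _ e) => //; rewrite def_c.
Qed.

(** A combination of lifts distinct from [s] maps to a combination of elements
    distinct from [phi s], because the lift of [phi s] is [s] itself. *)
Lemma inessential_image s C (l : {mpoly K[n]} -> {mpoly K[m]}) :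
    l (phi s) = s -> phi s \in C -> {in C, cancel l phi} ->
  inessential (map l C) s -> inessential C (phi s).
Proof.
move=> ls Cs lK [_ [t s_iness]]; split=> //; exists t => g'.
move=> /(ideal_exp_lift (t := t) phi_surj irrelevant_lift)[g /s_iness gen_sg <-].
rewrite -rmorphM; move: (s * g) gen_sg; apply: ideal_gen_min.
  exact/preimage_is_ideal/ideal_gen_is_ideal.
move=> _ [/mapP[c Cc ->] ne_lc_s] /=; rewrite lK //.
apply: ideal_gen_self; split=> //.
by apply: contraNneq ne_lc_s => ->; rewrite ls.
Qed.

(** Stated for an arbitrary graded surjection whose kernel is contained in [zS],
    whatever the number of variables of the target. *)
Theorem strongly_inessential_image s :
  strongly_inessential I s -> strongly_inessential barI (phi s).
Proof.
move=> [d [Is s_new s_iness]]; exists d.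
have bar_s_new : ~ ideal_gen (ideal_part_pred barI d) (phi s).
  move=> gen_s; apply/s_new/ext_sub_gen/ext_reflect => //.
  by apply: gen_part_ext => //; apply: phi_homog; case: Is.
split=> //; first exact: part_image.
move=> C Cstd Cs; have [C_homog Cgen _] := Cstd.
have [|c Cc|l [ls lK lI l_homog]] := homogeneous_lift (C := C) Is.
- apply/eqP => s0; apply: bar_s_new; rewrite s0.
  by case: (ideal_gen_is_ideal (ideal_part_pred barI d)).
- have [e c_e] := C_homog c Cc; exists e; split=> //.
  by rewrite -Cgen; apply: ideal_gen_self.
apply: (inessential_image (l := l)) => //; apply: s_iness.
  exact: standard_basis_lift.
by rewrite -ls map_f.
Qed.

End GradedQuotient.

Theorem proposition3p3 (K : closedFieldType) (n : nat)
    (I : set {mpoly K[n]}) (s : {mpoly K[n]}) (z : dhomog n K 1)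
    (psi : {rmorphism lin_quot z -> {mpoly K[n.-1]}}) :
  homogeneous_ideal I ->
  strongly_inessential I s ->
  regular_mod I (z : {mpoly K[n]}) ->
  graded_iso psi ->
  let bar (f : {mpoly K[n]}) := psi (\pi_(lin_quot z) f) in
  strongly_inessential [set bar f | f in I] (bar s).
Proof.
move=> I_homog s_iness z_reg [psi_bij psiC psi_homog] bar.
pose phi := GRing.RMorphism.clone _ _ (psi \o \pi_(lin_quot z)) _.
apply: (@strongly_inessential_image _ _ _ phi z) => //.
- move=> g; have [psi' _ psiK] := psi_bij.
  by exists (repr (psi' g)); rewrite /= reprK psiK.
(* [psi] being injective, the kernel is that of the projection, namely [zS]. *)
- move=> f phi_f0.
  have : \pi_(lin_quot z) f = \pi_(lin_quot z) 0.
    by apply: (bij_inj psi_bij); rewrite [LHS]phi_f0 !rmorph0.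
  by move/eqP; rewrite -Quotient.idealrBE subr0 => /asboolP.
- exact: dhomog_is_dhomog.
Qed.
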